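(* Let $S,\mathcal Z,h^{\mathcal Z},R$ and $g_R=R^*h^{\mathcal Z}$ be as in the context. Suppose $R$ has constant rank on an open subset $U\subset S$, and put $\mathcal K=\ker R\subset TS|_U$ and $\mathcal I=\operatorname{Im}R\subset\mathcal Z|_U$. Then there exists a unique smooth positive-definite fibre metric $\overline g_R$ on $TS|_U/\mathcal K$ such that $q^*\overline g_R=g_R$ on $U$, where $q:TS|_U\to TS|_U/\mathcal K$ is the quotient projection. Moreover, the induced bundle isomorphism $\overline R:TS|_U/\mathcal K\to\mathcal I$, $[X]\mapsto RX$, is an isometry with respect to $\overline g_R$ and the restriction of $h^{\mathcal Z}$ to $\mathcal I$.
   Context: $S$ is a smooth finite-dimensional manifold parameterizing a smooth family $\{g_p\}_{p\in S}$ of normalized Einstein metrics on a fixed smooth manifold $M$. The family comes with the following given data, which is all that the statement uses: a smooth real vector bundle $\mathcal Z\to S$ of finite rank (the observation bundle), a smooth positive-definite fibre metric $h^{\mathcal Z}$ on $\mathcal Z$, and a smooth vector bundle morphism $R:TS\to\mathcal Z$ over the identity of $S$, with fibre maps $R_p:T_pS\to\mathcal Z_p$. The response metric is $(g_R)_p(X,Y)=h^{\mathcal Z}_p(R_pX,R_pY)$. When $R$ has constant rank on $U$, $\mathcal K$ (the invisible bundle) and $\mathcal I$ (the observable bundle) are smooth vector subbundles. *)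

(* Defs.v *)
From HB Require Import structures.
From mathcomp Require Import all_boot all_order all_algebra.
From mathcomp Require Import all_classical all_reals.
From mathcomp Require Import topology normedtype landau derive.

Set Implicit Arguments.
Unset Strict Implicit.
Unset Printing Implicit Defensive.

Import Order.TTheory GRing.Theory Num.Theory.
Import numFieldNormedType.Exports.

Local Open Scope classical_set_scope.
Local Open Scope ring_scope.

Section Calculus.
Context {R : realType}.

(* C^k in the Frechet sense, on an open set A. The spaces are finite-dimensional
   in all uses, so the derivative is a C^k map into the space of linear maps
   iff all its evaluations x |-> 'd f x v are C^k. *)
Fixpoint Ck (k : nat) (V W : normedModType R) (A : set V) (f : V -> W) : Prop :=
  if k is k'.+1 then
    (forall x, A x -> differentiable f x) /\
    (forall v, Ck k' A (fun x => 'd f x v))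
  else forall x, A x -> {for x, continuous f}.

Definition smooth_on (V W : normedModType R) (A : set V) (f : V -> W) : Prop :=
  forall k, Ck k A f.

Section general.
Context {V W : normedModType R}.
Implicit Types (A : set V) (f g : V -> W).

Lemma near_eq_diff f g (x : V) : (\near x, f x = g x) ->
  differentiable f x -> differentiable g x /\ 'd g x = 'd f x :> (V -> W).
Proof.
move=> fg df.
have fgx : f x = g x by exact: nbhs_singleton fg.
have key : g \o shift x = cst (g x) + 'd f x +o_ 0 id.
  have /eqaddoP dfx := diff_locally df.
  apply/eqaddoP => e e0.
  have : \forall h \near (0 : V), f (h + x) = g (h + x).
    by move: fg; rewrite (near_shift 0) /= subr0.
  move=> fgh; have := dfx e e0; apply: filterS2 fgh => h /= E.
  by rewrite !fctE /= /shift /= E fgx.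
have E : 'd g x = 'd f x :> (V -> W).
  by apply: diff_unique => //; exact: diff_continuous.
split=> //; apply/diff_locallyP; rewrite E; split => //.
exact: diff_continuous.
Qed.

Lemma Ck_cont k A f : Ck k A f -> forall x, A x -> {for x, continuous f}.
Proof.
by case: k => //= k [df _] x Ax; apply: differentiable_continuous; exact: df.
Qed.

Lemma Ck_ext k A f g : open A -> {in A, f =1 g} -> Ck k A f -> Ck k A g.
Proof.
move=> oA; elim: k f g => [|k IH] f g fg /=.
  move=> cf x Ax; change (g @ x --> g x); rewrite -(fg x) ?inE //.
  apply: cvg_trans (cf x Ax); apply: near_eq_cvg.
  by apply: filterS (open_nbhs_nbhs (conj oA Ax)) => y Ay; rewrite fg ?inE.
have nfg x : A x -> \near x, f x = g x.
  by move=> Ax; apply: filterS (open_nbhs_nbhs (conj oA Ax)) => y Ay; rewrite fg ?inE.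
move=> [df ddf]; split=> [x Ax|v].
  by have [] := near_eq_diff (nfg x Ax) (df x Ax).
apply: IH (ddf v) => x; rewrite inE => Ax.
by have [_ ->] := near_eq_diff (nfg x Ax) (df x Ax).
Qed.

Lemma Ck_sub k A B f : B `<=` A -> Ck k A f -> Ck k B f.
Proof.
move=> BA; elim: k f => [|k IH] f /=; first by move=> h x /BA; exact: h.
by move=> [df ddf]; split=> [x /BA|v]; [exact: df|exact: IH].
Qed.

Lemma Ck_local k A f :
  (forall x, A x -> exists2 B, B x & Ck k B f) -> Ck k A f.
Proof.
elim: k f => [|k IH] f /= loc.
  by move=> x /loc[B Bx]; exact.
split=> [x /loc[B Bx [df _]]|v]; first exact: df.
by apply: IH => x /loc[B Bx [_ ddf]]; exists B.
Qed.

Lemma Ck_cst k A (w : W) : Ck k A (cst w).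
Proof.
elim: k w => [|k IH] w /=; first by move=> x _; exact: cst_continuous.
split=> [x _|v]; first exact: differentiable_cst.
by under eq_fun do rewrite diff_cst; exact: IH.
Qed.

Lemma CkS k A f : Ck k.+1 A f -> Ck k A f.
Proof.
elim: k f => [|k IH] f; first exact: Ck_cont.
by move=> [df ddf]; split=> // v; exact: IH.
Qed.

Lemma CkD k A f g : open A -> Ck k A f -> Ck k A g -> Ck k A (f \+ g).
Proof.
move=> oA; elim: k f g => [|k IH] f g /=.
  by move=> cf cg x Ax; apply: cvgD; [exact: cf|exact: cg].
move=> [df ddf] [dg ddg]; split=> [x Ax|v].
  by apply: differentiableD; [exact: df|exact: dg].
apply: Ck_ext (IH _ _ (ddf v) (ddg v)) => // x; rewrite inE => Ax /=.
by rewrite diffD; [|exact: df|exact: dg].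
Qed.

Lemma CkZl k A (a : V -> R) (w : W) : open A ->
  Ck k A a -> Ck k A (fun x => a x *: w).
Proof.
move=> oA; elim: k a => [|k IH] a /=.
  by move=> ca x Ax; apply: cvgZr_tmp; exact: ca.
move=> [da dda]; split=> [x Ax|v].
  by apply: differentiableZl; exact: da.
apply: Ck_ext (IH _ (dda v)) => // x; rewrite inE => Ax /=.
by rewrite diffZl; [|exact: da].
Qed.

Lemma Ck_lin k A (L : {linear V -> W}) : continuous L -> Ck k A L.
Proof.
move=> cL; case: k => [|k] /=; first by move=> x _; exact: cL.
split=> [x _|v]; first exact: linear_differentiable.
by under eq_fun do rewrite diff_lin //; exact: Ck_cst.
Qed.
End general.

Section scalar.
Context {V : normedModType R}.
Implicit Types (A : set V) (f g : V -> R).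

Lemma CkM k A f g : open A -> Ck k A f -> Ck k A g -> Ck k A (f \* g).
Proof.
move=> oA; elim: k f g => [|k IH] f g.
  by move=> cf cg x Ax; apply: cvgM; [exact: cf|exact: cg].
move=> Cf Cg; have [df ddf] := Cf; have [dg ddg] := Cg.
split=> [x Ax|v].
  by apply: differentiableM; [exact: df|exact: dg].
have := CkD oA (IH _ _ (CkS Cf) (ddg v)) (IH _ _ (CkS Cg) (ddf v)).
apply: Ck_ext => // x; rewrite inE => Ax /=.
by rewrite diffM; [|exact: df|exact: dg].
Qed.

Lemma CkV k A f : open A -> (forall x, A x -> f x != 0) ->
  Ck k A f -> Ck k A (fun x => (f x)^-1).
Proof.
move=> oA f0; elim: k => [|k IH].
  by move=> cf x Ax; apply: cvgV; [exact: f0|exact: cf].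
move=> Cf; have [df ddf] := Cf.
split=> [x Ax|v].
  by apply: differentiableV; [exact: df|exact: f0].
have IV := IH (CkS Cf).
have := CkM oA (CkM oA (CkM oA IV IV) (Ck_cst k A (-1 : R))) (ddf v).
apply: Ck_ext => // x; rewrite inE => Ax /=.
rewrite diffV; [|exact: df|exact: f0].
by rewrite /= mulrN1 -exprVn expr2.
Qed.
End scalar.

Section rows.
Context {V : normedModType R} {m : nat}.
Implicit Types (A : set V).

Lemma Ck_sum (W : normedModType R) k A I (r : seq I) (f : I -> V -> W) : open A ->
  (forall i, Ck k A (f i)) -> Ck k A (fun x : V => \sum_(i <- r) f i x : W).
Proof.
move=> oA Cf; elim: r => [|i r IH].
  under eq_fun do rewrite big_nil; exact: Ck_cst.
under eq_fun do rewrite big_cons.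
exact: CkD.
Qed.

Lemma CkrVP k A (f : V -> 'rV[R]_m) : open A ->
  Ck k A f <-> (forall j, Ck k A (fun x => f x 0 j)).
Proof.
move=> oA; split=> [Cf j|Cf].
  elim: k f Cf => [|k IH] f /=.
    move=> cf x Ax; apply: (@continuous_comp _ _ _ f (fun M : 'rV_m => M 0 j)).
      exact: cf.
    exact: coord_continuous.
  move=> [df ddf]; split=> [x Ax|v].
    apply: (@differentiable_comp _ _ _ _ f (fun M : 'rV_m => M 0 j)); first exact: df.
    exact: differentiable_coord.
  apply: Ck_ext (IH _ (ddf v)) => // x; rewrite inE => Ax.
  rewrite (@diff_comp _ _ _ _ f (fun M : 'rV_m => M 0 j)) /=; first last.
  - exact: differentiable_coord.
  - exact: df.
  have @L : {linear 'rV[R]_m -> R}.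
    by exists (fun N : 'rV[R]_m => N 0 j); do 2![eexists]; do ?[constructor];
     rewrite ?mxE// => ? *; rewrite ?mxE//; move=> ?; rewrite !mxE.
  by rewrite (@diff_lin _ _ _ L) //; exact: coord_continuous.
rewrite (_ : f = fun x => \sum_j (f x 0 j *: delta_mx 0 j)); last first.
  by apply/funext => x; exact: row_sum_delta.
by apply: Ck_sum => // j; exact: CkZl.
Qed.
End rows.

Section comp.

Lemma Ck_comp1 k m (V : normedModType R) (A : set V) (B : set 'rV[R]_m)
    (f : V -> 'rV[R]_m) (g : 'rV[R]_m -> R) : open A -> open B ->
  (forall x, A x -> B (f x)) -> Ck k A f -> Ck k B g -> Ck k A (g \o f).
Proof.
move=> oA oB AB; elim: k g => [|k IH] g.
  by move=> cf cg x Ax; apply: continuous_comp; [exact: cf|apply: cg; exact: AB].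
move=> Cf Cg; have [df ddf] := Cf; have [dg ddg] := Cg.
split=> [x Ax|v].
  by apply: differentiable_comp; [exact: df|apply: dg; exact: AB].
apply: (@Ck_ext _ _ _ _ (fun x => \sum_i ('d f x v 0 i * 'd g (f x) (delta_mx 0 i)))) => //.
  move=> x; rewrite inE => Ax.
  rewrite (@diff_comp _ _ _ _ f g); first last.
  - by apply: dg; exact: AB.
  - exact: df.
  rewrite /= [in RHS](row_sum_delta ('d f x v)) linear_sum.
  by apply: eq_bigr => i _; rewrite linearZ.
apply: Ck_sum => // i; apply: CkM => //.
  by have /(CkrVP _ _ oA) := ddf v; apply.
by apply: (IH (fun y => 'd g y (delta_mx 0 i))); [exact: CkS|exact: ddg].
Qed.

Lemma Ck_comp k m p (V : normedModType R) (A : set V) (B : set 'rV[R]_m)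
    (f : V -> 'rV[R]_m) (g : 'rV[R]_m -> 'rV[R]_p) : open A -> open B ->
  (forall x, A x -> B (f x)) -> Ck k A f -> Ck k B g -> Ck k A (g \o f).
Proof.
move=> oA oB AB Cf /(CkrVP _ _ oB) Cg; apply/(CkrVP _ _ oA) => j.
by apply: (Ck_comp1 oA oB AB Cf (Cg j)).
Qed.
End comp.
End Calculus.

Section Manifold.
Context {R : realType}.

(* cinv is only meaningful on the open set cmap @` cdom; elsewhere its values
   are arbitrary *)
Record chart (n : nat) (S : topologicalType) := Chart {
  cdom : set S;
  cmap : S -> 'rV[R]_n;
  cinv : 'rV[R]_n -> S;
  cdom_open : open cdom;
  cimg_open : open (cmap @` cdom);
  cmapK : forall p, cdom p -> cinv (cmap p) = p;
  cmap_continuous : forall p, cdom p -> {for p, continuous cmap};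
  cinv_continuous : forall x, (cmap @` cdom) x -> {for x, continuous cinv}
}.

Definition chart_compat n (S : topologicalType) (c d : chart n S) : Prop :=
  smooth_on (cmap c @` (cdom c `&` cdom d)) (cmap d \o cinv c).

Record manifold (n : nat) := Manifold {
  mcarrier :> topologicalType;
  atlas : set (chart n mcarrier);
  manifold_hausdorff : hausdorff_space mcarrier;
  manifold_second_countable : @second_countable mcarrier;
  atlas_cover : forall p : mcarrier, exists2 c, atlas c & cdom c p;
  atlas_compat : forall c d, atlas c -> atlas d -> chart_compat c d
}.

Definition msmooth n (S : manifold n) (V : normedModType R) (W : set S)
    (f : S -> V) : Prop :=
  forall c, atlas c -> smooth_on (cmap c @` (cdom c `&` W)) (f \o cinv c).

Section theory.
Context {n : nat} (S : manifold n).
Implicit Types (c d : chart n S) (p : S) (W : set S).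

Lemma open_cimg c W : open W -> open (cmap c @` (cdom c `&` W)).
Proof.
move=> oW; rewrite openE => _ [p [cp Wp] <-].
have ix : (cmap c @` cdom c) (cmap c p) by exists p.
have h1 : nbhs (cmap c p) (cmap c @` cdom c).
  by apply: open_nbhs_nbhs; split => //; exact: cimg_open.
have h2 : nbhs (cmap c p) (cinv c @^-1` W).
  apply: (cinv_continuous ix); rewrite cmapK //.
  exact: open_nbhs_nbhs.
apply: filterS2 h1 h2 => _ [q cq <-] /=; rewrite cmapK // => Wq.
by exists q.
Qed.

Lemma msmooth_ext (V : normedModType R) W (f g : S -> V) : open W ->
  (forall p, W p -> f p = g p) -> msmooth W f -> msmooth W g.
Proof.
move=> oW fg sf c ac k; have /(_ k) := sf c ac; apply: Ck_ext; first exact: open_cimg.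
by move=> x; rewrite inE => -[p [cp Wp] <-] /=; rewrite cmapK // fg.
Qed.

Lemma msmooth_sub (V : normedModType R) W W' (f : S -> V) :
  W' `<=` W -> msmooth W f -> msmooth W' f.
Proof.
move=> WW' sf c ac k; have /(_ k) := sf c ac; apply: Ck_sub.
by move=> _ [p [cp Wp] <-]; exists p => //; split => //; exact: WW'.
Qed.

Lemma msmooth_cst (V : normedModType R) W (v : V) : msmooth W (cst v).
Proof. by move=> c ac k; exact: Ck_cst. Qed.

Lemma msmoothD (V : normedModType R) W (f g : S -> V) : open W ->
  msmooth W f -> msmooth W g -> msmooth W (fun p => f p + g p).
Proof.
move=> oW sf sg c ac k.
exact: (CkD (open_cimg oW) (sf c ac k) (sg c ac k)).
Qed.

Lemma msmoothZl (V : normedModType R) W (a : S -> R) (v : V) : open W ->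
  msmooth W a -> msmooth W (fun p => a p *: v).
Proof.
move=> oW sf c ac k.
exact: (CkZl _ (open_cimg oW) (sf c ac k)).
Qed.

Lemma msmoothM W (f g : S -> R) : open W ->
  msmooth W f -> msmooth W g -> msmooth W (fun p => f p * g p).
Proof.
move=> oW sf sg c ac k.
exact: (CkM (open_cimg oW) (sf c ac k) (sg c ac k)).
Qed.

Lemma msmoothV W (f : S -> R) : open W -> (forall p, W p -> f p != 0) ->
  msmooth W f -> msmooth W (fun p => (f p)^-1).
Proof.
move=> oW f0 sf c ac k.
apply: (CkV (open_cimg oW) _ (sf c ac k)).
by move=> _ [p [cp Wp] <-] /=; rewrite cmapK //; exact: f0.
Qed.

Lemma msmooth_sum (V : normedModType R) W I (r : seq I) (f : I -> S -> V) :
  open W -> (forall i, msmooth W (f i)) ->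
  msmooth W (fun p => \sum_(i <- r) f i p).
Proof.
move=> oW sf c ac k.
exact: (Ck_sum _ (open_cimg oW) (fun i => sf i c ac k)).
Qed.

Lemma msmooth_prod W I (r : seq I) (f : I -> S -> R) :
  open W -> (forall i, msmooth W (f i)) ->
  msmooth W (fun p => \prod_(i <- r) f i p).
Proof.
move=> oW sf; elim: r => [|i r IH].
  under eq_fun do rewrite big_nil; exact: msmooth_cst.
under eq_fun do rewrite big_cons.
exact: msmoothM.
Qed.

Lemma msmoothrVP m W (f : S -> 'rV[R]_m) : open W ->
  msmooth W f <-> (forall j, msmooth W (fun p => f p 0 j)).
Proof.
move=> oW; split=> [sf j c ac k|sf c ac k].
  by have /(CkrVP _ _ (open_cimg oW)) := sf c ac k; apply.
by apply/(CkrVP _ _ (open_cimg oW)) => j; exact: sf.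
Qed.

Lemma msmooth_local (V : normedModType R) W (f : S -> V) :
  (forall p, W p -> exists2 W', W' p & msmooth W' f) -> msmooth W f.
Proof.
move=> loc c ac k; apply: Ck_local => _ [p [cp /loc[W' W'p sf]] <-].
by exists (cmap c @` (cdom c `&` W')); [exists p|exact: sf].
Qed.

End theory.

Section tangent.
Context {n : nat} (S : manifold n) (p : S).

Definition chart_at := {c : chart n S | atlas c /\ cdom c p}.

Definition dtransition (c d : chart n S) : {linear 'rV[R]_n -> 'rV[R]_n} :=
  'd (cmap d \o cinv c) (cmap c p).

Lemma transition_differentiable (c d : chart_at) :
  differentiable (cmap (sval d) \o cinv (sval c)) (cmap (sval c) p).
Proof.
case: c d => [c [ac cp]] [d [ad dp]] /=.
have [+ _] := atlas_compat ac ad 1; apply.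
by exists p.
Qed.

Lemma dtransition_cocycle (c d e : chart_at) v :
  dtransition (sval d) (sval e) (dtransition (sval c) (sval d) v) =
  dtransition (sval c) (sval e) v.
Proof.
have dcd := transition_differentiable c d.
have dde := transition_differentiable d e.
have dce := transition_differentiable c e.
case: c d e dcd dde dce => [c [ac cp]] [d [ad dp]] [e [ae ep]] /= dcd dde dce.
rewrite /dtransition.
have dK : (cmap d \o cinv c) (cmap c p) = cmap d p by rewrite /= cmapK.
rewrite -dK in dde.
transitivity (('d (cmap e \o cinv d) ((cmap d \o cinv c) (cmap c p)) \o
  'd (cmap d \o cinv c) (cmap c p)) v).
  by rewrite [in RHS]dK.
rewrite -(diff_comp dcd dde).
have dce' : differentiable ((cmap e \o cinv d) \o (cmap d \o cinv c)) (cmap c p).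
  exact: differentiable_comp.
suff fg : \forall x \near cmap c p,
    ((cmap e \o cinv d) \o (cmap d \o cinv c)) x = (cmap e \o cinv c) x.
  have [_ dE] := near_eq_diff fg dce'.
  exact: (esym (congr1 (fun h : 'rV[R]_n -> 'rV[R]_n => h v) dE)).
have nb : nbhs (cmap c p) (cmap c @` (cdom c `&` cdom d)).
  apply: open_nbhs_nbhs; split; first by apply: open_cimg; exact: cdom_open.
  by exists p.
by apply: filterS nb => _ [q [cq dq] <-] /=; rewrite !(cmapK cq) (cmapK dq).
Qed.

Lemma dtransition_id (c : chart_at) v : dtransition (sval c) (sval c) v = v.
Proof.
case: c => [c [ac cp]] /=; rewrite /dtransition.
have fg : \forall x \near cmap c p, idfun x = (cmap c \o cinv c) x.
  have nb : nbhs (cmap c p) (cmap c @` cdom c).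
    by apply: open_nbhs_nbhs; split; [exact: cimg_open|exists p].
  by apply: filterS nb => _ [q cq <-] /=; rewrite (cmapK cq).
have dI := is_diff_id (cmap c p).
have [_ dE] := near_eq_diff fg (@ex_diff _ _ _ _ _ _ _ dI).
rewrite [LHS](congr1 (fun h : 'rV[R]_n -> 'rV[R]_n => h v) dE).
exact: (congr1 (fun h : 'rV[R]_n -> 'rV[R]_n => h v) (@diff_val _ _ _ _ _ _ _ dI)).
Qed.

(* A tangent vector at p is the family of its component vectors in the charts
   around p, related by the derivatives of the transition maps. *)
Definition is_tangent (v : chart_at -> 'rV[R]_n) : Prop :=
  forall c d, v d = dtransition (sval c) (sval d) (v c).

Definition tangent_pred : {pred chart_at -> 'rV[R]_n} :=
  fun v => `[< is_tangent v >].

Record tangent_space := TangentVector {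
  components :> chart_at -> 'rV[R]_n;
  _ : components \in tangent_pred }.

Lemma tangent_submod_closed : submod_closed tangent_pred.
Proof.
split=> [|a u v /asboolP ut /asboolP vt]; apply/asboolP => c d.
  exact: esym (linear0 _).
rewrite (_ : (a *: u + v) d = a *: u d + v d) // (ut c d) (vt c d).
by rewrite -linearP.
Qed.
HB.instance Definition _ := GRing.isSubmodClosed.Build R
  (chart_at -> 'rV[R]_n) tangent_pred tangent_submod_closed.

HB.instance Definition _ := [isSub for components].
HB.instance Definition _ := [Choice of tangent_space by <:].
HB.instance Definition _ := [SubChoice_isSubLmodule of tangent_space by <:].

Lemma components_linear (c : chart_at) :
  linear (fun v : tangent_space => v c).
Proof. by []. Qed.

Lemma tangentP (v : tangent_space) : is_tangent v.
Proof. by case: v => v /= /asboolP. Qed.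

Lemma tangent_of_subproof (c : chart_at) (w : 'rV[R]_n) :
  (fun d => dtransition (sval c) (sval d) w) \in tangent_pred.
Proof. by apply/asboolP => d e; exact: (esym (dtransition_cocycle c d e w)). Qed.

Definition tangent_of (c : chart_at) (w : 'rV[R]_n) : tangent_space :=
  TangentVector (tangent_of_subproof c w).

Lemma components_bij (c : chart_at) :
  bijective (fun v : tangent_space => v c).
Proof.
exists (tangent_of c) => [v|w]; last exact: dtransition_id.
by apply/val_inj/funext => d; exact: esym (tangentP v c d).
Qed.

Lemma chart_at_exists : chart_at.
Proof. by have := cid2 (atlas_cover p) => -[c ac cp]; exists c. Qed.

Lemma tangent_vect_axiom : Vector.axiom n tangent_space.
Proof.
exists (fun v : tangent_space => v chart_at_exists).
- exact: components_linear.
- exact: components_bij.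
Qed.
HB.instance Definition _ :=
  Lmodule_hasFinDim.Build R tangent_space tangent_vect_axiom.

End tangent.
End Manifold.
Arguments manifold R n : clear implicits.
Arguments tangent_space {R n} S p.
Arguments chart R n S : clear implicits.

Section QuotientSpace.
Context {F : fieldType} {V : vectType F} (K : {vspace V}).
Local Open Scope quotient_scope.

(* the vector space V / K of cosets *)
Definition quotv : Type := Quotient.quot (pred_of_vspace K : zmodClosed V).
HB.instance Definition _ := GRing.Zmodule.on quotv.

Definition quot_pi (v : V) : quotv := \pi_(Quotient.quot (pred_of_vspace K : zmodClosed V)) v.
Definition quot_repr (x : quotv) : V := repr x.

Lemma quot_reprK x : quot_pi (quot_repr x) = x.
Proof. exact: reprK. Qed.

Lemma quot_piE u v : (quot_pi u = quot_pi v) <-> (u - v \in K).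
Proof.
rewrite -[_ \in K]/(Quotient.equiv (pred_of_vspace K : zmodClosed V) u v).
rewrite Quotient.equivE Quotient.idealrBE.
by split=> [/eqP|/eqP].
Qed.

Lemma quot_piD u v : quot_pi (u + v) = quot_pi u + quot_pi v.
Proof. exact: raddfD. Qed.

Definition quot_scale (a : F) (x : quotv) : quotv := quot_pi (a *: quot_repr x).

Lemma quot_scaleE a v : quot_scale a (quot_pi v) = quot_pi (a *: v).
Proof.
apply/quot_piE; rewrite -scalerBr; apply: memvZ.
by apply/quot_piE; rewrite quot_reprK.
Qed.

Fact quot_scaleA a b x : quot_scale a (quot_scale b x) = quot_scale (a * b) x.
Proof. by rewrite -(quot_reprK x) !quot_scaleE scalerA. Qed.
Fact quot_scale1 : left_id 1 quot_scale.
Proof. by move=> x; rewrite -(quot_reprK x) quot_scaleE scale1r. Qed.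
Fact quot_scaleDr : right_distributive quot_scale +%R.
Proof.
move=> a x y; rewrite -(quot_reprK x) -(quot_reprK y).
by rewrite -quot_piD !quot_scaleE scalerDr quot_piD.
Qed.
Fact quot_scaleDl x : {morph quot_scale^~ x : a b / a + b}.
Proof.
by move=> a b; rewrite -(quot_reprK x) !quot_scaleE scalerDl quot_piD.
Qed.
HB.instance Definition _ := GRing.Zmodule_isLmodule.Build F quotv
  quot_scaleA quot_scale1 quot_scaleDr quot_scaleDl.

Lemma quot_pi_linear : linear quot_pi.
Proof. by move=> a u v; rewrite quot_piD -quot_scaleE. Qed.
HB.instance Definition _ := GRing.isLinear.Build F V quotv _ quot_pi quot_pi_linear.

Definition quot_coord (x : quotv) : 'rV[F]_(\dim K^C) :=
  \row_i coord (vbasis K^C) i (daddv_pi K^C K (quot_repr x)).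

Let pi := daddv_pi K^C K.

Let pi_add v : pi v + daddv_pi K K^C v = v.
Proof.
apply: daddv_pi_add; first by rewrite capvC capv_compl.
by rewrite addvC addv_complf memvf.
Qed.

Let pi_id v : v \in (K^C)%VS -> pi v = v.
Proof. by apply: daddv_pi_id; rewrite capvC capv_compl. Qed.

Let pi0 v : v \in K -> pi v = 0.
Proof.
move=> vK; apply: (addIr v); rewrite add0r -[in RHS](pi_add v).
by rewrite (daddv_pi_id (capv_compl K) vK).
Qed.

Let quot_pi_pi v : quot_pi (pi v) = quot_pi v.
Proof.
by apply/quot_piE; rewrite -[in X in _ - X](pi_add v) opprD addNKr memvN memv_pi.
Qed.

Let quot_coord_pi v :
  quot_coord (quot_pi v) = \row_i coord (vbasis K^C) i (pi v).
Proof.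
apply/rowP => i; rewrite !mxE; congr (coord _ _ _).
apply/eqP; rewrite -subr_eq0 -linearB; apply/eqP/pi0.
by apply/quot_piE; rewrite quot_reprK.
Qed.

Fact quot_vect_axiom : Vector.axiom (\dim K^C) quotv.
Proof.
exists quot_coord.
  move=> a x y; rewrite -(quot_reprK x) -(quot_reprK y) -quot_pi_linear.
  by rewrite !quot_coord_pi; apply/rowP => i; rewrite !mxE !linearP.
exists (fun w : 'rV_(\dim K^C) => quot_pi (\sum_i w 0 i *: (vbasis K^C)`_i)).
  move=> x; rewrite -(quot_reprK x) quot_coord_pi -[RHS]quot_pi_pi.
  congr quot_pi; under eq_bigr do rewrite mxE.
  by rewrite -coord_vbasis // memv_pi.
move=> w; rewrite quot_coord_pi; apply/rowP => i; rewrite mxE pi_id; last first.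
  by apply: memv_suml => j _; rewrite memvZ // vbasis_mem // mem_nth ?size_tuple.
by rewrite coord_sum_free // (basis_free (vbasisP _)).
Qed.
HB.instance Definition _ := Lmodule_hasFinDim.Build F quotv quot_vect_axiom.

Definition quot_proj : 'Hom(V, quotv) := linfun quot_pi.
End QuotientSpace.

Section QuotMore.
Context {F : fieldType} {V : vectType F} (K : {vspace V}).
Lemma quot_projE u v : (quot_proj K u = quot_proj K v) <-> (u - v \in K).
Proof. by rewrite !lfunE; exact: quot_piE. Qed.
Lemma quot_projVK : cancel (quot_proj K)^-1%VF (quot_proj K).
Proof.
move=> x; apply: limg_lfunVK; rewrite -(quot_reprK x).
by rewrite -[quot_pi K _](lfunE (quot_pi K)) memv_img ?memvf.
Qed.
Lemma quot_projKB v : (quot_proj K)^-1%VF (quot_proj K v) - v \in K.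
Proof. by apply/quot_projE; rewrite quot_projVK. Qed.
End QuotMore.

Section Lfun.
Context {F : fieldType} {V W : vectType F}.
Lemma lfun_bijK (f : 'Hom(V, W)) : bijective f ->
  cancel f (f^-1)%VF /\ cancel (f^-1)%VF f.
Proof.
move=> bf; split; first by apply: lker0_lfunK; apply/lker0P; exact: bij_inj.
move=> w; apply: limg_lfunVK; have [g _ gK] := bf.
by rewrite -(gK w) memv_img ?memvf.
Qed.
End Lfun.

Section Bundle.
Context {R : realType} {n : nat} {S : manifold R n}.
Implicit Types (U W : set S) (p : S).

(* E p is the fibre at p. The maps tmap t p are only meaningful for p in tdom t;
   there (tmap t p)^-1 is the inverse of tmap t p. *)
Record trivialization (E : S -> vectType R) (r : nat) := Trivialization {
  tdom : set S;
  tmap : forall p, 'Hom(E p, 'rV[R]_r);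
  tdom_open : open tdom;
  tmap_bij : forall p, tdom p -> bijective (tmap p)
}.

Definition triv_compat E r s (t : trivialization E r) (t' : trivialization E s) :=
  forall w : 'rV[R]_r, msmooth (tdom t `&` tdom t')
    (fun p => tmap t' p ((tmap t p)^-1%VF w)).

(* Smooth vector bundles of rank r over the open set U of S. Fibres, morphisms
   and metrics are given as families over all of S, but the part of them outside
   U is irrelevant: no condition is imposed there, and two of them are to be
   identified when they agree over U. *)
Record vbundle (U : set S) (r : nat) := VBundle {
  fibre :> S -> vectType R;
  trivs : set (trivialization fibre r);
  trivs_sub : forall t, trivs t -> tdom t `<=` U;
  trivs_cover : forall p, U p -> exists2 t, trivs t & tdom t p;
  trivs_compat : forall t t', trivs t -> trivs t' -> triv_compat t t'
}.

Record vbmor U r s (E : vbundle U r) (F : vbundle U s) := VBMor {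
  bmap :> forall p, 'Hom(E p, F p);
  bmap_smooth : forall t t', trivs t -> trivs t' -> forall w : 'rV[R]_r,
    msmooth (tdom t `&` tdom t')
      (fun p => tmap t' p (bmap p ((tmap t p)^-1%VF w)))
}.

Record fibre_metric U r (E : vbundle U r) := FibreMetric {
  fm :> forall p, E p -> E p -> R;
  fm_linear : forall p, U p -> forall (a : R) (u v w : E p),
    fm (a *: u + v) w = a * fm u w + fm v w;
  fm_sym : forall p, U p -> forall u v : E p, fm u v = fm v u;
  fm_pos : forall p, U p -> forall v : E p, v != 0 -> 0 < fm v v;
  fm_smooth : forall t, trivs t -> forall w w' : 'rV[R]_r,
    msmooth (tdom t)
      (fun p => fm ((tmap t p)^-1%VF w) ((tmap t p)^-1%VF w'))
}.
Arguments fm {U r E} _ p u v.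

Section helpers.

Lemma trivK E r (t : trivialization E r) p : tdom t p ->
  cancel (tmap t p) (tmap t p)^-1%VF.
Proof. by move=> tp; have [] := lfun_bijK (tmap_bij tp). Qed.

Lemma trivVK E r (t : trivialization E r) p : tdom t p ->
  cancel (tmap t p)^-1%VF (tmap t p).
Proof. by move=> tp; have [] := lfun_bijK (tmap_bij tp). Qed.

Lemma tdomI E r s (t : trivialization E r) E' (t' : trivialization E' s) :
  open (tdom t `&` tdom t').
Proof. by apply: openI; exact: tdom_open. Qed.

Lemma msmooth_app m m' W (L : S -> 'Hom('rV[R]_m, 'rV[R]_m')) (a : S -> 'rV[R]_m) :
  open W -> (forall w, msmooth W (fun p => L p w)) -> msmooth W a ->
  msmooth W (fun p => L p (a p)).
Proof.
move=> oW sL /(msmoothrVP _ oW) sa; apply/(msmoothrVP _ oW) => j.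
rewrite (_ : (fun p => _) = fun p => \sum_i (a p 0 i * L p (delta_mx 0 i) 0 j)).
  apply: msmooth_sum => // i; apply: msmoothM => //.
  by have /(msmoothrVP _ oW) := sL (delta_mx 0 i).
apply/funext => p; rewrite [X in L p X]row_sum_delta linear_sum summxE.
by apply: eq_bigr => i _; rewrite linearZ mxE.
Qed.

Lemma msmooth_cont (V : normedModType R) W (f : S -> V) p :
  W p -> msmooth W f -> {for p, continuous f}.
Proof.
move=> Wp sf; have [c ac cp] := atlas_cover p.
have /= := sf c ac 0 (cmap c p); move=> /(_ (ex_intro2 _ _ p (conj cp Wp) erefl)) h.
have h2 : {for p, continuous ((f \o cinv c) \o cmap c)}.
  by apply: continuous_comp => //; exact: cmap_continuous.
have E : \forall q \near p, ((f \o cinv c) \o cmap c) q = f q.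
  have : nbhs p (cdom c) by apply: open_nbhs_nbhs; split => //; exact: cdom_open.
  by apply: filterS => q cq /=; rewrite cmapK.
change (f @ p --> f p); rewrite -(nbhs_singleton E).
by apply: cvg_trans h2; apply: near_eq_cvg.
Qed.

Section compatible.
Context {U : set S} {r : nat} (E : vbundle U r).

(* t belongs to the maximal atlas of E *)
Definition compatible_triv s (t : trivialization E s) :=
  tdom t `<=` U /\ forall t0, trivs t0 -> triv_compat t t0 /\ triv_compat t0 t.

Lemma trivs_compatible t : trivs t -> compatible_triv t.
Proof.
move=> Et; split; first exact: trivs_sub.
by move=> t0 Et0; split; exact: trivs_compat.
Qed.

Lemma compatible_compat s s' (t : trivialization E s) (t' : trivialization E s') :
  compatible_triv t -> compatible_triv t' -> triv_compat t t'.
Proof.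
move=> [tU ct] [_ ct'] w; apply: msmooth_local => p [tp t'p].
have [t0 Et0 t0p] := trivs_cover E (tU p tp).
pose W := (tdom t `&` tdom t') `&` tdom t0; exists W => //.
have oW : open W by apply: openI; [exact: tdomI|exact: tdom_open].
apply: (@msmooth_ext _ _ _ _ _ (fun p => (tmap t' p \o (tmap t0 p)^-1)%VF
   (tmap t0 p ((tmap t p)^-1%VF w)))) => //.
  by move=> q [[tq t'q] t0q]; rewrite lfunE /= trivK.
apply: msmooth_app => //.
  move=> w'; apply: (@msmooth_sub _ _ _ _ (tdom t0 `&` tdom t')); first by move=> q [[]].
  have [_ h] := ct' _ Et0; apply: (msmooth_ext (tdomI _ _) _ (h w')).
  by move=> q _; rewrite lfunE.
apply: (@msmooth_sub _ _ _ _ (tdom t `&` tdom t0)); first by move=> q [[]].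
by have [h _] := ct _ Et0; exact: h.
Qed.

End compatible.

Lemma bmap_smooth_compatible U r r' (E : vbundle U r) (F : vbundle U r')
   (f : vbmor E F) s s' (t : trivialization E s) (t' : trivialization F s') :
  compatible_triv t -> compatible_triv t' ->
  forall w, msmooth (tdom t `&` tdom t')
      (fun p => tmap t' p (f p ((tmap t p)^-1%VF w))).
Proof.
move=> ct ct' w; apply: msmooth_local => p [tp t'p].
have [t0 Et0 t0p] := trivs_cover E (ct.1 p tp).
have [t1 Et1 t1p] := trivs_cover F (ct'.1 p t'p).
pose W := (tdom t `&` tdom t') `&` (tdom t0 `&` tdom t1); exists W => //.
have oW : open W by apply: openI; exact: tdomI.
apply: (@msmooth_ext _ _ _ _ _ (fun p => (tmap t' p \o (tmap t1 p)^-1)%VF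
   ((tmap t1 p \o f p \o (tmap t0 p)^-1)%VF
   (tmap t0 p ((tmap t p)^-1%VF w))))) => //.
  by move=> q [[tq t'q] [t0q t1q]]; rewrite !lfunE /= !trivK // lfunE /= trivK.
apply: msmooth_app => //.
  move=> w'; apply: (@msmooth_sub _ _ _ _ (tdom t1 `&` tdom t')); first by move=> q [[? ?] []].
  apply: (msmooth_ext (tdomI _ _) _ ((ct'.2 _ Et1).2 w')).
  by move=> q _; rewrite lfunE.
apply: msmooth_app => //.
  move=> w'; apply: (@msmooth_sub _ _ _ _ (tdom t0 `&` tdom t1)); first by move=> q [[? ?] []].
  apply: (msmooth_ext (tdomI _ _) _ (bmap_smooth f Et0 Et1 w')).
  by move=> q _; rewrite !lfunE /= lfunE.
apply: (@msmooth_sub _ _ _ _ (tdom t `&` tdom t0)); first by move=> q [[? ?] []].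
exact: (ct.2 _ Et0).1.
Qed.

Lemma fm_linear_r U r (E : vbundle U r) (h : fibre_metric E) p : U p ->
  forall (a : R) (u v w : E p), h p w (a *: u + v) = a * h p w u + h p w v.
Proof.
by move=> Up a u v w; rewrite (fm_sym h Up) (fm_linear h Up) !(fm_sym h Up w).
Qed.

Lemma fm_sum U r (E : vbundle U r) (h : fibre_metric E) p : U p ->
  forall I (s s' : seq I) (a b : I -> R) (u v : I -> E p),
  h p (\sum_(i <- s) a i *: u i) (\sum_(i <- s') b i *: v i) =
  \sum_(i <- s) \sum_(j <- s') (a i * b j * h p (u i) (v j)).
Proof.
move=> Up I s s' a b u v.
have h0l w : h p 0 w = 0.
  have := fm_linear h Up 1 0 0 w; rewrite scale1r addr0 mul1r => /eqP.
  by rewrite -subr_eq0 opprD addrA subrr sub0r oppr_eq0 => /eqP.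
elim: s => [|i s IH]; first by rewrite !big_nil h0l.
rewrite !big_cons (fm_linear h Up) IH; congr (_ + _).
elim: s' {IH} => [|j s' IH]; first by rewrite !big_nil (fm_sym h Up) h0l mulr0.
by rewrite !big_cons fm_linear_r // mulrDr IH mulrA.
Qed.

Lemma fm_smooth_compatible U r (E : vbundle U r) (h : fibre_metric E)
    s (t : trivialization E s) : compatible_triv t ->
  forall w w', msmooth (tdom t)
      (fun p => h p ((tmap t p)^-1%VF w) ((tmap t p)^-1%VF w')).
Proof.
move=> ct w w'; apply: msmooth_local => p tp.
have [t0 Et0 t0p] := trivs_cover E (ct.1 p tp).
pose W := tdom t `&` tdom t0; exists W => //.
have oW : open W by exact: tdomI.
pose a w p := tmap t0 p ((tmap t p)^-1%VF w).
have sa w1 : msmooth W (a w1) by exact: (ct.2 _ Et0).1.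
apply: (@msmooth_ext _ _ _ _ _ (fun p => \sum_i \sum_j (a w p 0 i * a w' p 0 j *
   h p ((tmap t0 p)^-1%VF (delta_mx 0 i)) ((tmap t0 p)^-1%VF (delta_mx 0 j))))) => //.
  move=> q [tq t0q]; have Uq := ct.1 q tq.
  have aE w1 : (tmap t q)^-1%VF w1 =
      \sum_i a w1 q 0 i *: (tmap t0 q)^-1%VF (delta_mx 0 i).
    rewrite -[LHS](trivK t0q) -/(a w1 q) {1}(row_sum_delta (a w1 q)) linear_sum.
    by apply: eq_bigr => i _; rewrite linearZ.
  by rewrite !aE fm_sum.
have sW (V : normedModType R) (f : S -> V) : msmooth (tdom t0) f -> msmooth W f.
  by apply: msmooth_sub => q [].
apply: msmooth_sum => // i; apply: msmooth_sum => // j.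
apply: msmoothM => //; first apply: msmoothM => //.
- by have /(msmoothrVP _ oW) := sa w; apply.
- by have /(msmoothrVP _ oW) := sa w'; apply.
by apply: sW; exact: fm_smooth.
Qed.

End helpers.
End Bundle.

Section TangentBundle.
Context {R : realType} {n : nat} (S : manifold R n).

Section comp.
Variables (c : chart R n S) (p : S).
Definition tangent_comp (v : tangent_space S p) : 'rV[R]_n :=
  if pselect (atlas c /\ cdom c p) is left h then v (exist _ c h) else 0.
Lemma tangent_comp_linear : linear tangent_comp.
Proof.
move=> a u v; rewrite /tangent_comp; case: pselect => // _.
by rewrite scaler0 addr0.
Qed.
HB.instance Definition _ :=
  GRing.isLinear.Build R (tangent_space S p) 'rV[R]_n _ tangent_comp
    tangent_comp_linear.
End comp.

Section triv.
Variables (c : chart R n S) (ac : atlas c).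

Lemma tangent_comp_bij p : cdom c p -> bijective (linfun (@tangent_comp c p)).
Proof.
move=> cp; apply: eq_bij (fun v => esym (lfunE _ v)).
rewrite /= /tangent_comp; case: pselect => [h|[]//].
exact: components_bij.
Qed.

Definition tangent_triv : trivialization (tangent_space S) n :=
  Trivialization (@cdom_open _ _ _ c) tangent_comp_bij.

Lemma tangent_trivV p (cp : cdom c p) w :
  (tmap tangent_triv p)^-1%VF w = tangent_of (exist _ c (conj ac cp)) w.
Proof.
apply: (bij_inj (tangent_comp_bij cp)).
rewrite (trivVK (t := tangent_triv)) // lfunE /= /tangent_comp.
case: pselect => [h|[]//]; rewrite (Prop_irrelevance h (conj ac cp)).
exact: (esym (dtransition_id (exist _ c (conj ac cp)) w)).
Qed.

End triv.

Definition tangent_trivs : set (trivialization (tangent_space S) n) :=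
  [set t | exists (c : chart R n S) (ac : atlas c), t = tangent_triv ac].

Lemma tangent_compat t t' :
  tangent_trivs t -> tangent_trivs t' -> triv_compat t t'.
Proof.
move=> [c [ac ->]] [d [ad ->]] w.
apply: (@msmooth_ext _ _ _ _ _ (fun p => dtransition p c d w)).
- exact: tdomI.
- move=> p [/= cp dp]; rewrite (tangent_trivV ac cp) lfunE /= /tangent_comp.
  by case: pselect => [h|[]].
move=> e ae k /=.
have oW : open (cdom c `&` cdom d) by apply: openI; exact: cdom_open.
have [_ /(_ w) sd] := atlas_compat ac ad k.+1.
pose W := cmap e @` (cdom e `&` (cdom c `&` cdom d)).
have oE : open W by exact: open_cimg.
have oC : open (cmap c @` (cdom c `&` cdom d)) by apply: open_cimg; exact: cdom_open.
apply: (@Ck_comp _ k n n _ W _ (cmap c \o cinv e)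
  (fun y => 'd (cmap d \o cinv c) y w) oE oC).
- by move=> _ [p [ep [cp dp]] <-] /=; rewrite cmapK //; exists p.
- apply: Ck_sub (atlas_compat ae ac k).
  by move=> _ [p [ep [cp dp]] <-]; exists p.
- exact: sd.
Qed.

Lemma tangent_cover p : [set: S] p -> exists2 t, tangent_trivs t & tdom t p.
Proof.
by move=> _; have [c ac cp] := atlas_cover p; exists (tangent_triv ac) => //; exists c, ac.
Qed.

Definition tangent_bundle : vbundle [set: S] n :=
  VBundle (fun t _ p _ => I) tangent_cover tangent_compat.

End TangentBundle.

Section Restriction.
Context {R : realType} {n : nat} {S : manifold R n} (U : set S) (oU : open U).

Definition triv_restr E r (t : trivialization E r) : trivialization E r :=
  @Trivialization _ _ _ E r (tdom t `&` U) (tmap t) (openI (tdom_open t) oU)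
    (fun p tp => tmap_bij tp.1).

Section vb.
Context {r : nat} (E : vbundle [set: S] r).
Definition restr_trivs : set (trivialization E r) :=
  [set triv_restr t | t in @trivs _ _ _ _ _ E].

Lemma restr_sub t : restr_trivs t -> tdom t `<=` U.
Proof. by move=> [t0 _ <-] p []. Qed.

Lemma restr_cover p : U p -> exists2 t, restr_trivs t & tdom t p.
Proof.
move=> Up; have [t Et tp] := trivs_cover E (p:=p) I.
by exists (triv_restr t) => //; exists t.
Qed.

Lemma restr_compat t t' : restr_trivs t -> restr_trivs t' -> triv_compat t t'.
Proof.
move=> [t0 Et0 <-] [t1 Et1 <-] w.
by apply: msmooth_sub (trivs_compat Et0 Et1 w) => p [[? ?] []].
Qed.

Definition vb_restr : vbundle U r := VBundle restr_sub restr_cover restr_compat.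
End vb.

Lemma bmor_restr_smooth r s (E : vbundle [set: S] r) (F : vbundle [set: S] s)
  (f : vbmor E F) t t' : trivs (v := vb_restr E) t -> trivs (v := vb_restr F) t' ->
  forall w, msmooth (tdom t `&` tdom t')
      (fun p => tmap t' p (f p ((tmap t p)^-1%VF w))).
Proof.
move=> [t0 Et0 <-] [t1 Et1 <-] w.
by apply: msmooth_sub (bmap_smooth f Et0 Et1 w) => p [[? ?] []].
Qed.

Definition vbmor_restr r s (E : vbundle [set: S] r) (F : vbundle [set: S] s)
  (f : vbmor E F) : vbmor (vb_restr E) (vb_restr F) :=
  @VBMor _ _ _ _ _ _ (vb_restr E) (vb_restr F) f (@bmor_restr_smooth _ _ E F f).

Lemma fm_restr_smooth r (E : vbundle [set: S] r) (h : fibre_metric E) t :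
  trivs (v := vb_restr E) t -> forall w w', msmooth (tdom t)
      (fun p => h p ((tmap t p)^-1%VF w) ((tmap t p)^-1%VF w')).
Proof.
move=> [t0 Et0 <-] w w'.
by apply: msmooth_sub (fm_smooth h Et0 w w') => p [].
Qed.

Definition fm_restr r (E : vbundle [set: S] r) (h : fibre_metric E) :
    fibre_metric (vb_restr E) :=
  @FibreMetric _ _ _ _ _ (vb_restr E) h (fun p _ => fm_linear h (p := p) I)
    (fun p _ => fm_sym h (p := p) I) (fun p _ => fm_pos h (p := p) I)
    (@fm_restr_smooth _ _ h).
End Restriction.

Section Subbundle.
Context {R : realType} {n : nat} {S : manifold R n} {U : set S} {r : nat}.
Variable (E : vbundle U r).

(* t identifies K p with the subspace of vectors of R^(k+l) whose last l
   coordinates vanish *)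
Definition adapted_triv (k l : nat) (K : forall p, {vspace E p})
    (t : trivialization E (k + l)) : Prop :=
  compatible_triv t /\
  forall p, tdom t p -> forall v, v \in K p <-> rsubmx (tmap t p v) = 0.

Definition is_subbundle (k l : nat) (K : forall p, {vspace E p}) : Prop :=
  forall p, U p -> exists2 t : trivialization E (k + l), adapted_triv K t & tdom t p.

Section constr.
Variables (k l : nat) (K : forall p, {vspace E p}) (hK : is_subbundle k l K).

Section triv.
Variables (t : trivialization E (k + l)) (adt : adapted_triv K t).

Definition sub_tmap p : 'Hom(subvs_of (K p), 'rV[R]_k) :=
  (linfun lsubmx \o tmap t p \o linfun vsval)%VF.

Lemma sub_tmapE p v : sub_tmap p v = lsubmx (tmap t p (vsval v)).
Proof. by rewrite /sub_tmap lfunE /= lfunE /= !lfunE. Qed.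

Lemma sub_inv_mem p w : tdom t p -> (tmap t p)^-1%VF (row_mx w 0) \in K p.
Proof. by move=> tp; apply/(adt.2 p tp); rewrite trivVK // row_mxKr. Qed.

Lemma sub_tmap_bij p : tdom t p -> bijective (sub_tmap p).
Proof.
move=> tp; exists (fun w => vsproj (K p) ((tmap t p)^-1%VF (row_mx w 0))) => [v|w].
  rewrite sub_tmapE.
  have /(adt.2 p tp) v0 : vsval v \in K p by exact: subvsP.
  by rewrite -[X in row_mx _ X]v0 hsubmxK trivK // vsvalK.
by rewrite sub_tmapE vsprojK ?sub_inv_mem // trivVK // row_mxKl.
Qed.

Definition sub_triv : trivialization (fun p => subvs_of (K p)) k :=
  Trivialization (tdom_open t) sub_tmap_bij.

Lemma sub_trivV p w : tdom t p ->
  vsval ((tmap sub_triv p)^-1%VF w) = (tmap t p)^-1%VF (row_mx w 0).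
Proof.
move=> tp; rewrite -[RHS](vsprojK (sub_inv_mem w tp)); congr vsval.
apply: (bij_inj (sub_tmap_bij tp)); rewrite (trivVK (t := sub_triv)) //.
by rewrite sub_tmapE vsprojK ?sub_inv_mem // trivVK // row_mxKl.
Qed.

Definition quot_tmap p : 'Hom(quotv (K p), 'rV[R]_l) :=
  (linfun rsubmx \o tmap t p \o (quot_proj (K p))^-1)%VF.

Lemma quot_tmapE p v : tdom t p ->
  quot_tmap p (quot_proj (K p) v) = rsubmx (tmap t p v).
Proof.
move=> tp; rewrite /quot_tmap lfunE /= lfunE /= lfunE /=.
apply/eqP; rewrite -subr_eq0 -!linearB; apply/eqP.
by apply/(adt.2 p tp); exact: quot_projKB.
Qed.

Lemma quot_tmap_bij p : tdom t p -> bijective (quot_tmap p).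
Proof.
move=> tp; exists (fun w => quot_proj (K p) ((tmap t p)^-1%VF (row_mx 0 w))) => [x|w].
  rewrite -(quot_projVK x) quot_tmapE //; apply/quot_projE.
  by apply/(adt.2 p tp); rewrite !linearB /= trivVK // row_mxKr subrr.
by rewrite quot_tmapE // trivVK // row_mxKr.
Qed.

Definition quot_triv : trivialization (fun p => quotv (K p)) l :=
  Trivialization (tdom_open t) quot_tmap_bij.

Lemma quot_trivV p w : tdom t p ->
  (tmap quot_triv p)^-1%VF w = quot_proj (K p) ((tmap t p)^-1%VF (row_mx 0 w)).
Proof.
move=> tp; apply: (bij_inj (quot_tmap_bij tp)); rewrite (trivVK (t := quot_triv)) //.
by rewrite quot_tmapE // trivVK // row_mxKr.
Qed.

End triv.

Definition sub_trivs : set (trivialization (fun p => subvs_of (K p)) k) :=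
  [set t' | exists t (adt : adapted_triv K t), t' = sub_triv adt].

Definition quot_trivs : set (trivialization (fun p => quotv (K p)) l) :=
  [set t' | exists t (adt : adapted_triv K t), t' = quot_triv adt].

Lemma sub_trivs_sub t : sub_trivs t -> tdom t `<=` U.
Proof. by move=> [t0 [at0 ->]]; exact: at0.1.1. Qed.

Lemma quot_trivs_sub t : quot_trivs t -> tdom t `<=` U.
Proof. by move=> [t0 [at0 ->]]; exact: at0.1.1. Qed.

Lemma sub_trivs_cover p : U p -> exists2 t, sub_trivs t & tdom t p.
Proof.
move=> /hK[t adt tp]; exists (sub_triv adt) => //.
by exists t, adt.
Qed.

Lemma quot_trivs_cover p : U p -> exists2 t, quot_trivs t & tdom t p.
Proof.
move=> /hK[t adt tp]; exists (quot_triv adt) => //.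
by exists t, adt.
Qed.

Lemma msmooth_lsubmx k' l' W (f : S -> 'rV[R]_(k' + l')) : open W ->
  msmooth W f -> msmooth W (fun p => lsubmx (f p)).
Proof.
move=> oW /(msmoothrVP _ oW) sf; apply/(msmoothrVP _ oW) => j.
by under eq_fun do rewrite mxE; exact: sf.
Qed.

Lemma msmooth_rsubmx k' l' W (f : S -> 'rV[R]_(k' + l')) : open W ->
  msmooth W f -> msmooth W (fun p => rsubmx (f p)).
Proof.
move=> oW /(msmoothrVP _ oW) sf; apply/(msmoothrVP _ oW) => j.
by under eq_fun do rewrite mxE; exact: sf.
Qed.

Lemma sub_trivs_compat t t' : sub_trivs t -> sub_trivs t' -> triv_compat t t'.
Proof.
move=> [t0 [a0 ->]] [t1 [a1 ->]] w.
apply: (msmooth_ext (tdomI _ _) _ (msmooth_lsubmx (tdomI _ _)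
   (compatible_compat a0.1 a1.1 (row_mx w 0)))) => p [/= tp t'p].
by rewrite sub_tmapE (sub_trivV a0 w tp).
Qed.

Lemma quot_trivs_compat t t' : quot_trivs t -> quot_trivs t' -> triv_compat t t'.
Proof.
move=> [t0 [a0 ->]] [t1 [a1 ->]] w.
apply: (msmooth_ext (tdomI _ _) _ (msmooth_rsubmx (tdomI _ _)
   (compatible_compat a0.1 a1.1 (row_mx 0 w)))) => p [/= tp t'p].
by rewrite (quot_trivV a0 w tp) (quot_tmapE a1).
Qed.

Definition sub_vbundle : vbundle U k :=
  VBundle sub_trivs_sub sub_trivs_cover sub_trivs_compat.

Definition quot_vbundle : vbundle U l :=
  VBundle quot_trivs_sub quot_trivs_cover quot_trivs_compat.

Lemma quot_vbmor_smooth t t' : trivs (v := E) t -> trivs (v := quot_vbundle) t' ->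
  forall w, msmooth (tdom t `&` tdom t')
      (fun p => tmap t' p (quot_proj (K p) ((tmap t p)^-1%VF w))).
Proof.
move=> Et [t1 [a1 ->]] w.
apply: (msmooth_ext (tdomI _ _) _ (msmooth_rsubmx (tdomI _ _)
   (compatible_compat (trivs_compatible Et) a1.1 w))) => p [/= tp t'p].
by rewrite (quot_tmapE a1).
Qed.

Definition quot_vbmor : vbmor E quot_vbundle :=
  @VBMor _ _ _ _ _ _ E quot_vbundle (fun p => quot_proj (K p)) quot_vbmor_smooth.

Section submetric.
Variable h : fibre_metric E.

Definition sub_fm p (u v : sub_vbundle p) : R := h p (vsval u) (vsval v).

Lemma sub_fm_linear p : U p -> forall (a : R) (u v w : sub_vbundle p),
  sub_fm (a *: u + v) w = a * sub_fm u w + sub_fm v w.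
Proof. by move=> Up a u v w; rewrite /sub_fm -(fm_linear h Up). Qed.

Lemma sub_fm_sym p : U p -> forall (u v : sub_vbundle p),
  sub_fm u v = sub_fm v u.
Proof. by move=> Up u v; exact: fm_sym. Qed.

Lemma sub_fm_pos p : U p -> forall (v : sub_vbundle p), v != 0 -> 0 < sub_fm v v.
Proof.
move=> Up v v0; apply: (fm_pos h Up); apply: contra_neq v0 => v0.
by apply: val_inj; rewrite /= v0.
Qed.

Lemma sub_fm_smooth t : trivs (v := sub_vbundle) t -> forall w w',
  msmooth (tdom t) (fun p => sub_fm ((tmap t p)^-1%VF w) ((tmap t p)^-1%VF w')).
Proof.
move=> [t0 [a0 ->]] w w'.
apply: (msmooth_ext (tdom_open t0) _ (fm_smooth_compatible h a0.1
  (row_mx w 0) (row_mx w' 0))) => p tp.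
by rewrite /sub_fm !(sub_trivV a0 _ tp).
Qed.

Definition sub_metric : fibre_metric sub_vbundle :=
  FibreMetric sub_fm_linear sub_fm_sym sub_fm_pos sub_fm_smooth.
End submetric.

End constr.
End Subbundle.
Arguments is_subbundle {R n S U r} E k l K.

Section Matrices.
Context {F : fieldType}.

Lemma rank_compl_rows m n (A : 'M[F]_(m, n)) s : \rank A = s ->
  exists (X : 'M_(s, m)) (Y : 'M_(n - s, n)), row_full (col_mx (X *m A) Y).
Proof.
move=> <-; have /submxP[X XE] : (row_base A <= A)%MS by rewrite eq_row_base.
have [Y YE] : exists Y : 'M_(n - \rank A, n), (Y :=: A^C%MS)%MS.
  by rewrite -mxrank_compl; exists (row_base (A^C)%MS); exact: eq_row_base.
exists X, Y; rewrite -XE -sub1mx -addsmxE.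
have := addsmx_compl_full A; rewrite -sub1mx => /submx_trans; apply.
by rewrite addsmxS // ?YE // eq_row_base.
Qed.

Lemma rank_compl_cols m n (A : 'M[F]_(m, n)) s : \rank A = s ->
  exists (D : 'M_(m, m - s)) (N : 'M_(n, s)), \rank (row_mx D (A *m N)) = m.
Proof.
rewrite -mxrank_tr => /rank_compl_rows[X [Y full]].
exists Y^T, X^T; rewrite -mxrank_tr tr_row_mx trmxK trmx_mul trmxK.
apply/eqP; rewrite -/(row_full _) -sub1mx -addsmxE addsmxC addsmxE sub1mx.
exact: full.
Qed.

Lemma dim_lin1 m n (L : 'Hom('rV[F]_m, 'rV[F]_n)) :
  \rank (lin1_mx L) = \dim (limg L).
Proof.
set A := lin1_mx L.
have LE v : L v = v *m A by rewrite mul_rV_lin1.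
pose G : 'Hom('rV[F]_(\rank A), 'rV[F]_n) := linfun (mulmxr (row_base A)).
have GE v : G v = v *m row_base A by rewrite lfunE.
have kG : lker G == 0%VS.
  apply/lker0P => u v; rewrite !GE; apply: row_free_inj.
  exact: row_base_free.
have -> : limg L = limg G.
  apply/eqP; rewrite eqEsubv; apply/andP; split; apply/subvP => _ /memv_imgP[v _ ->].
    have -> : L v = G (v *m col_base A) by rewrite GE LE -mulmxA mulmx_base.
    by rewrite memv_img // memvf.
  have /submxP[X XE] : (row_base A <= A)%MS by rewrite eq_row_base.
  by rewrite GE XE mulmxA -LE memv_img // memvf.
by rewrite limg_dim_eq ?(eqP kG) ?capv0 // dimvf /dim /= mul1n.
Qed.
End Matrices.

Section LfunDim.
Context {F : fieldType} {V W : vectType F}.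
Lemma bij_limg (f : 'Hom(V, W)) : bijective f -> limg f = fullv.
Proof.
move=> bf; apply/eqP; rewrite eqEsubv subvf /=; apply/subvP => w _.
by have [_ fK] := lfun_bijK bf; rewrite -(fK w) memv_img ?memvf.
Qed.
Lemma bij_lker (f : 'Hom(V, W)) : bijective f -> lker f = 0%VS.
Proof. by move=> bf; apply/eqP/lker0P; exact: bij_inj. Qed.
Lemma bij_dim (f : 'Hom(V, W)) : bijective f -> \dim {:V} = \dim {:W}.
Proof.
by move=> bf; rewrite -(bij_limg bf) limg_dim_eq // bij_lker // capv0.
Qed.
End LfunDim.

Lemma dim_rsub (F : fieldType) (V : vectType F) k l (f : 'Hom(V, 'rV[F]_(k + l))) :
  bijective f -> \dim {:V} = (k + l)%N /\
  \dim (lker (linfun rsubmx \o f)%VF) = k.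
Proof.
move=> bf.
have dV : \dim {:V} = (k + l)%N by rewrite (bij_dim bf) dimvf /dim /= mul1n.
split => //.
have := limg_ker_dim (linfun rsubmx \o f)%VF fullv; rewrite capfv dV.
have -> : limg (linfun rsubmx \o f)%VF = fullv.
  apply/eqP; rewrite eqEsubv subvf /=; apply/subvP => w _.
  have [_ fK] := lfun_bijK bf.
  rewrite (_ : w = (linfun rsubmx \o f)%VF ((f^-1)%VF (row_mx 0 w))).
    by rewrite memv_img ?memvf.
  by rewrite lfunE /= fK lfunE /= row_mxKr.
by rewrite dimvf /dim /= mul1n => /addIn.
Qed.

Section SmoothMatrices.
Context {R : realType} {n : nat} {S : manifold R n}.
Implicit Types (W : set S).

Definition smooth_mx W m m' (M : S -> 'M[R]_(m, m')) : Prop :=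
  forall i j, msmooth W (fun p => M p i j).

Lemma smooth_mx_sub W W' m m' (M : S -> 'M[R]_(m, m')) : W' `<=` W ->
  smooth_mx W M -> smooth_mx W' M.
Proof. by move=> WW sM i j; exact: msmooth_sub WW (sM i j). Qed.

Lemma smooth_mx_cst W m m' (M : 'M[R]_(m, m')) : smooth_mx W (cst M).
Proof. by move=> i j; exact: msmooth_cst. Qed.

Lemma smooth_mx_mul W m1 m2 m3 (M : S -> 'M[R]_(m1, m2)) (N : S -> 'M[R]_(m2, m3)) :
  open W -> smooth_mx W M -> smooth_mx W N -> smooth_mx W (fun p => M p *m N p).
Proof.
move=> oW sM sN i j; under eq_fun do rewrite mxE.
by apply: msmooth_sum => // k; exact: msmoothM.
Qed.

Lemma smooth_mx_row W m m1 m2 (M : S -> 'M[R]_(m, m1)) (N : S -> 'M[R]_(m, m2)) :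
  smooth_mx W M -> smooth_mx W N -> smooth_mx W (fun p => row_mx (M p) (N p)).
Proof.
by move=> sM sN i j; under eq_fun do rewrite mxE; case: (fintype.split j) => k; [exact: sM|exact: sN].
Qed.

Lemma smooth_mx_col W m m1 m2 (M : S -> 'M[R]_(m1, m)) (N : S -> 'M[R]_(m2, m)) :
  smooth_mx W M -> smooth_mx W N -> smooth_mx W (fun p => col_mx (M p) (N p)).
Proof.
by move=> sM sN i j; under eq_fun do rewrite mxE; case: (fintype.split i) => k; [exact: sM|exact: sN].
Qed.

Lemma smooth_mxrV W m (M : S -> 'rV[R]_m) : open W ->
  smooth_mx W M <-> msmooth W M.
Proof.
move=> oW; split=> [sM|/(msmoothrVP _ oW) sM i j]; last by rewrite ord1.
by apply/(msmoothrVP _ oW).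
Qed.

Lemma smooth_det W m (M : S -> 'M[R]_m) : open W ->
  smooth_mx W M -> msmooth W (fun p => \det (M p)).
Proof.
move=> oW sM; rewrite /determinant; apply: msmooth_sum => // s.
apply: msmoothM => //; first exact: msmooth_cst.
exact: msmooth_prod.
Qed.

Lemma smooth_inv m m' (e : m = m') (M : S -> 'M[R]_(m, m')) W0 p0 :
  open W0 -> W0 p0 -> smooth_mx W0 M -> \rank (M p0) = m ->
  exists W (Mi : S -> 'M[R]_(m', m)),
  [/\ open W, W p0, W `<=` W0, smooth_mx W Mi &
   forall p, W p -> M p *m Mi p = 1%:M /\ Mi p *m M p = 1%:M].
Proof.
subst m' => oW0 W0p sM rk.
pose W := W0 `&` [set p | \det (M p) != 0].
have oW : open W.
  rewrite openE => p [W0p' d0].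
  have nW : nbhs p W0 by exact: open_nbhs_nbhs.
  have cd := msmooth_cont W0p' (smooth_det oW0 sM).
  have nd : nbhs p ((fun q => \det (M q)) @^-1` [set y | y != 0]).
    by apply: cd; apply: open_nbhs_nbhs; split => //; exact: open_neq.
  by apply: filterS2 nW nd => q.
have WW0 : W `<=` W0 by move=> p [].
exists W, (fun p => (\det (M p))^-1 *: \adj (M p)); split => //.
- split => //=; rewrite -unitfE -unitmxE -row_free_unit /row_free.
  exact/eqP.
- move=> i j; under eq_fun do rewrite !mxE.
  apply: msmoothM => //.
    apply: msmoothV => //; first by move=> p [].
    by apply: smooth_det => //; exact: smooth_mx_sub sM.
  apply: msmoothM => //; first exact: msmooth_cst.
  apply: smooth_det => // i' j'; under eq_fun do rewrite !mxE.
  exact: msmooth_sub (sM _ _).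
- move=> p [W0p' /= d0]; split.
    by rewrite -scalemxAr mul_mx_adj scale_scalar_mx mulVf.
  by rewrite -scalemxAl mul_adj_mx scale_scalar_mx mulVf.
Qed.

End SmoothMatrices.

Definition constant_rank (R : realType) (n : nat) (S : manifold R n)
    (V : set S) (r r' : nat) (E : vbundle V r) (F : vbundle V r')
    (f : vbmor E F) (U : set S) (s : nat) : Prop :=
  forall p, U p -> \dim (limg (f p)) = s.

Section ConstantRank.
Context {R : realType} {n : nat} {S : manifold R n} {U : set S}.

Section retriv.
Context {r : nat} (E : vbundle U r).
Variables (t0 : trivialization E r) (Et0 : trivs t0).
Variables (m : nat) (W : set S) (M : S -> 'M[R]_(r, m)) (Mi : S -> 'M[R]_(m, r)).
Hypotheses (oW : open W) (W0 : W `<=` tdom t0).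
Hypotheses (sM : smooth_mx W M) (sMi : smooth_mx W Mi).
Hypothesis (MK : forall p, W p -> M p *m Mi p = 1%:M /\ Mi p *m M p = 1%:M).

Definition retriv_map p : 'Hom(E p, 'rV[R]_m) :=
  (linfun (mulmxr (M p)) \o tmap t0 p)%VF.

Lemma retriv_mapE p v : retriv_map p v = tmap t0 p v *m M p.
Proof. by rewrite /retriv_map lfunE /= lfunE. Qed.

Lemma retriv_bij p : W p -> bijective (retriv_map p).
Proof.
move=> Wp; have t0p := W0 Wp; have [K1 K2] := MK Wp.
exists (fun w => (tmap t0 p)^-1%VF (w *m Mi p)) => [v|w].
  by rewrite retriv_mapE -mulmxA K1 mulmx1 trivK.
by rewrite retriv_mapE trivVK // -mulmxA K2 mulmx1.
Qed.

Definition retriv : trivialization E m := Trivialization oW retriv_bij.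

Lemma retrivV p w : W p -> (tmap retriv p)^-1%VF w = (tmap t0 p)^-1%VF (w *m Mi p).
Proof.
move=> Wp; apply: (bij_inj (retriv_bij Wp)); rewrite (trivVK (t := retriv)) //.
have t0p := W0 Wp; have [K1 K2] := MK Wp.
by rewrite retriv_mapE trivVK // -mulmxA K2 mulmx1.
Qed.

Lemma retriv_compatible : compatible_triv retriv.
Proof.
split=> [p /W0|t Et]; first exact: trivs_sub.
split=> w.
  have oV : open (W `&` tdom t) by exact: (tdomI retriv t).
  apply: (@msmooth_ext _ _ _ _ _ (fun p => (tmap t p \o (tmap t0 p)^-1)%VF (w *m Mi p))) => //.
    by move=> p [Wp tp]; rewrite lfunE /= retrivV.
  apply: msmooth_app => //.
    move=> w'; apply: (@msmooth_sub _ _ _ _ (tdom t0 `&` tdom t)).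
      by move=> p [/W0].
    apply: (msmooth_ext (tdomI _ _) _ (trivs_compat Et0 Et w')).
    by move=> q _; rewrite lfunE.
  apply/smooth_mxrV => //; apply: smooth_mx_mul => //; first exact: smooth_mx_cst.
  by apply: smooth_mx_sub sMi => p [].
have oV : open (tdom t `&` W) by exact: (tdomI t retriv).
apply: (@msmooth_ext _ _ _ _ _ (fun p => tmap t0 p ((tmap t p)^-1%VF w) *m M p)) => //.
  by move=> p _; rewrite retriv_mapE.
apply/smooth_mxrV => //; apply: smooth_mx_mul => //.
  apply/smooth_mxrV => //; apply: msmooth_sub (trivs_compat Et Et0 w).
  by move=> p [? /W0].
by apply: smooth_mx_sub sM => p [].
Qed.
End retriv.

Context {r r' : nat} {E : vbundle U r} {F : vbundle U r'} (f : vbmor E F).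
Variables (s : nat) (hrank : constant_rank f U s).

Section local.
Variables (t0 : trivialization E r) (t1 : trivialization F r').
Hypotheses (Et0 : trivs t0) (Ft1 : trivs t1).

Let L p : 'Hom('rV[R]_r, 'rV[R]_r') := (tmap t1 p \o f p \o (tmap t0 p)^-1)%VF.
Definition local_mx p : 'M[R]_(r, r') := lin1_mx (L p).
Let W0 := tdom t0 `&` tdom t1.

Lemma local_mxE p w : w *m local_mx p = tmap t1 p (f p ((tmap t0 p)^-1%VF w)).
Proof. by rewrite /local_mx mul_rV_lin1 /L /= !comp_lfunE. Qed.

Lemma local_mx_smooth : smooth_mx W0 local_mx.
Proof.
move=> i j.
have /(msmoothrVP _ (tdomI _ _))/(_ j) := bmap_smooth f Et0 Ft1 (delta_mx 0 i).
apply: (msmooth_ext (tdomI _ _)) => p _.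
by rewrite -local_mxE -rowE mxE.
Qed.

Lemma local_mx_rank p : W0 p -> \rank (local_mx p) = s.
Proof.
move=> [t0p t1p]; rewrite dim_lin1 /L -(hrank (trivs_sub Et0 t0p)).
have bV : bijective (tmap t0 p)^-1%VF.
  by exists (tmap t0 p); [exact: trivVK|exact: trivK].
rewrite !limg_comp (bij_limg bV) limg_dim_eq // (bij_lker (tmap_bij t1p)).
exact: capv0.
Qed.
End local.

Lemma kernel_subbundle : is_subbundle E (r - s) s (fun p => lker (f p)).
Proof.
move=> p0 Up0.
have [t0 Et0 t0p] := trivs_cover E Up0; have [t1 Ft1 t1p] := trivs_cover F Up0.
pose A := local_mx t0 t1; pose W0 := tdom t0 `&` tdom t1.
have sA : smooth_mx W0 A by exact: local_mx_smooth.
have rA : \rank (A p0) = s by exact: local_mx_rank.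
have sr : (s <= r)%N by rewrite -rA rank_leq_row.
have [D [N rk]] := rank_compl_cols rA.
pose M p := row_mx D (A p *m N).
have oW0 : open W0 by exact: tdomI.
have sM : smooth_mx W0 M.
  apply: smooth_mx_row; first exact: smooth_mx_cst.
  by apply: smooth_mx_mul => //; exact: smooth_mx_cst.
have [W [Mi [oW Wp0 WW0 sMi MK]]] :=
  smooth_inv (esym (subnK sr)) oW0 (conj t0p t1p) sM rk.
have W1 : W `<=` tdom t0 by move=> p /WW0[].
pose t := retriv oW W1 MK.
exists t => //; split.
  by apply: retriv_compatible => //; exact: smooth_mx_sub sM.
move=> p Wp v.
have [t0p' t1p'] := WW0 _ Wp.
pose g := (linfun rsubmx \o tmap t p)%VF.
have -> : lker (f p) = lker g.
  apply/eqP; rewrite eqEdim; apply/andP; split.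
    apply/subvP => u; rewrite !memv_ker => /eqP fu.
    rewrite lfunE /= lfunE /= retriv_mapE /M mul_mx_row row_mxKr mulmxA.
    by rewrite local_mxE trivK // fu linear0 mul0mx.
  have [dE ->] := dim_rsub (tmap_bij (t := t) Wp).
  have := limg_ker_dim (f p) fullv; rewrite capfv dE hrank; last exact: trivs_sub t0p'.
  by move=> /addIn ->.
by rewrite memv_ker lfunE /= lfunE /=; split=> [/eqP|->].
Qed.

Lemma image_subbundle : is_subbundle F s (r' - s) (fun p => limg (f p)).
Proof.
move=> p0 Up0.
have [t0 Et0 t0p] := trivs_cover E Up0; have [t1 Ft1 t1p] := trivs_cover F Up0.
pose A := local_mx t0 t1; pose W0 := tdom t0 `&` tdom t1.
have sA : smooth_mx W0 A by exact: local_mx_smooth.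
have rA : \rank (A p0) = s by exact: local_mx_rank.
have sr : (s <= r')%N by rewrite -rA rank_leq_col.
have [X [Y full]] := rank_compl_rows rA.
pose M p := col_mx (X *m A p) Y.
have oW0 : open W0 by exact: tdomI.
have sM : smooth_mx W0 M.
  apply: smooth_mx_col; last exact: smooth_mx_cst.
  by apply: smooth_mx_mul => //; exact: smooth_mx_cst.
have rk : \rank (M p0) = (s + (r' - s))%N by move/eqP: full => ->; rewrite subnKC.
have [W [Mi [oW Wp0 WW0 sMi MK]]] :=
  smooth_inv (subnKC sr) oW0 (conj t0p t1p) sM rk.
have W1 : W `<=` tdom t1 by move=> p /WW0[].
have MK' p : W p -> Mi p *m M p = 1%:M /\ M p *m Mi p = 1%:M.
  by move=> /MK[].
pose t := retriv oW W1 MK'.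
exists t => //; split.
  by apply: retriv_compatible => //; exact: smooth_mx_sub sM.
move=> p Wp v.
have [t0p' t1p'] := WW0 _ Wp.
pose g := (linfun rsubmx \o tmap t p)%VF.
have -> : limg (f p) = lker g.
  apply/esym/eqP; rewrite eqEdim; apply/andP; split; last first.
    have [_ ->] := dim_rsub (tmap_bij (t := t) Wp).
    by rewrite hrank //; exact: trivs_sub t0p'.
  apply/subvP => u; rewrite memv_ker lfunE /= lfunE /= => /eqP u0.
  have : tmap t1 p u = lsubmx (tmap t p u) *m (X *m A p).
    have -> : lsubmx (tmap t p u) *m (X *m A p) = tmap t p u *m M p.
      by rewrite -[in RHS](hsubmxK (tmap t p u)) u0 mul_row_col mul0mx addr0.
    by rewrite retriv_mapE -mulmxA (MK' _ Wp).1 mulmx1.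
  rewrite mulmxA local_mxE => /(bij_inj (tmap_bij t1p')) ->.
  by rewrite memv_img // memvf.
by rewrite memv_ker lfunE /= lfunE /=; split=> [/eqP|->].
Qed.

End ConstantRank.

Section Induced.
Context {R : realType} {n : nat} {S : manifold R n} {U : set S} {r r' : nat}.
Context {E : vbundle U r} {F : vbundle U r'}.

Definition pullback_form (f : vbmor E F) (h : fibre_metric F)
  (p : S) (u v : E p) : R := h p (f p u) (f p v).

Definition is_isometry (g : fibre_metric E) (h : fibre_metric F) (f : vbmor E F) :
    Prop :=
  forall p, U p -> forall u v : E p, h p (f p u) (f p v) = g p u v.

Definition bundle_iso (f : vbmor E F) : Prop :=
  exists g : vbmor F E,
    forall p, U p -> cancel (f p) (g p) /\ cancel (g p) (f p).

Variables (f : vbmor E F) (s : nat) (rk : constant_rank f U s).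

Definition coimage_bundle : vbundle U s := quot_vbundle (kernel_subbundle rk).

Definition coimage_proj : vbmor E coimage_bundle :=
  quot_vbmor (kernel_subbundle rk).

Definition image_bundle : vbundle U s := sub_vbundle (image_subbundle rk).

(* [X] |-> f X, computed on the representative given by a linear section of the
   projection; induced_mapE shows that every representative gives the same *)
Definition induced_map p : 'Hom(coimage_bundle p, image_bundle p) :=
  (linfun (vsproj (limg (f p))) \o f p \o (quot_proj (lker (f p)))^-1)%VF.

Lemma induced_mapE p (X : E p) :
  vsval (induced_map p (coimage_proj p X)) = f p X.
Proof.
rewrite /induced_map comp_lfunE comp_lfunE lfunE /=.
rewrite vsprojK ?memv_img ?memvf //.
apply/eqP; rewrite -subr_eq0 -linearB; apply/eqP/eqP.
by rewrite -memv_ker; exact: quot_projKB.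
Qed.

Lemma induced_map_smooth t t' : trivs (v := coimage_bundle) t ->
  trivs (v := image_bundle) t' -> forall w,
  msmooth (tdom t `&` tdom t')
    (fun p => tmap t' p (induced_map p ((tmap t p)^-1%VF w))).
Proof.
move=> [t0 [a0 ->]] [t1 [a1 ->]] w.
apply: (msmooth_ext (tdomI _ _) _ (msmooth_lsubmx (tdomI _ _)
  (bmap_smooth_compatible f a0.1 a1.1 (row_mx 0 w)))) => p [/= t0p t1p].
by rewrite (quot_trivV a0 w t0p) sub_tmapE induced_mapE.
Qed.

Definition induced_vbmor : vbmor coimage_bundle image_bundle :=
  VBMor induced_map_smooth.

End Induced.

(* Main.v *)
(** The fibre maps of [rhobar] are linear isomorphisms onto the image of [rho],
    so the pullback of [hI] by [rhobar] is a smooth positive-definite metric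
    on the quotient, and it descends [g_R] because [rhobar \o q = rho]. Since [q]
    is onto on fibres, [q^* g] determines [g]. The inverse of [rhobar] is smooth
    because its local matrices are inverses of smooth matrices. *)
Require Import Defs.
From HB Require Import structures.
From mathcomp Require Import all_boot all_order all_algebra.
From mathcomp Require Import all_classical all_reals.
From mathcomp Require Import topology normedtype landau derive.

Set Implicit Arguments.
Unset Strict Implicit.
Unset Printing Implicit Defensive.

Import Order.TTheory GRing.Theory Num.Theory.
Import numFieldNormedType.Exports.

Local Open Scope classical_set_scope.
Local Open Scope ring_scope.

Section FibreMetrics.
Context {R : realType} {n : nat} {S : manifold R n} {U : set S}.

(** [fm_smooth] covers only constant coordinate vectors. Expanding bilinearly in the frame [e]
    leaves finitely many products of smooth coefficients with such values. *)
Lemma msmooth_fm r (E : vbundle U r) (h : fibre_metric E) t (W : set S)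
    (a b : S -> 'rV[R]_r) :
  trivs t -> open W -> W `<=` tdom t -> msmooth W a -> msmooth W b ->
  msmooth W (fun p => h p ((tmap t p)^-1%VF (a p)) ((tmap t p)^-1%VF (b p))).
Proof.
move=> Et oW Wt /(msmoothrVP _ oW) sa /(msmoothrVP _ oW) sb.
pose e i p := (tmap t p)^-1%VF (delta_mx 0 i).
apply: (@msmooth_ext _ _ _ _ _
  (fun p => \sum_i \sum_j (a p 0 i * b p 0 j * h p (e i p) (e j p)))) => //.
  move=> p Wp.
  have invE w : (tmap t p)^-1%VF w = \sum_i w 0 i *: e i p.
    rewrite {1}(row_sum_delta w) linear_sum.
    by apply: eq_bigr => i _; rewrite linearZ.
  by rewrite !invE fm_sum //; exact: trivs_sub (Wt _ Wp).
apply: msmooth_sum => // i; apply: msmooth_sum => // j.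
by apply: msmoothM; [|exact: msmoothM|exact: msmooth_sub (fm_smooth h Et _ _)].
Qed.

Context {r r' : nat} {E : vbundle U r} {F : vbundle U r'}.
Variables (f : vbmor E F) (h : fibre_metric F).
Hypothesis f_inj : forall p, U p -> injective (f p).

(** Locally, read in a trivialization [t'] of [F], the vectors [f p ((tmap t p)^-1%VF w)] have
    smooth but varying coordinates, which is the case handled by [msmooth_fm]. *)
Lemma pullback_form_smooth t : trivs t -> forall w w', msmooth (tdom t)
  (fun p => pullback_form f h ((tmap t p)^-1%VF w) ((tmap t p)^-1%VF w')).
Proof.
move=> Et w w'; apply: msmooth_local => p tp.
have [t' Ft' t'p] := trivs_cover F (trivs_sub Et tp).
exists (tdom t `&` tdom t') => //.
have oW : open (tdom t `&` tdom t') by exact: tdomI.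
have Wt' : tdom t `&` tdom t' `<=` tdom t' by move=> q [].
apply: (msmooth_ext oW _ (msmooth_fm h Ft' oW Wt'
  (bmap_smooth f Et Ft' w) (bmap_smooth f Et Ft' w'))) => q [_ t'q].
by rewrite !trivK.
Qed.

Lemma pullback_form_linear p : U p -> forall (a : R) (u v w : E p),
  pullback_form f h (a *: u + v) w =
  a * pullback_form f h u w + pullback_form f h v w.
Proof. by move=> Up a u v w; rewrite /pullback_form linearP fm_linear. Qed.

Lemma pullback_form_sym p : U p -> forall u v : E p,
  pullback_form f h u v = pullback_form f h v u.
Proof. by move=> Up u v; exact: fm_sym. Qed.

Lemma pullback_form_pos p : U p -> forall v : E p,
  v != 0 -> 0 < pullback_form f h v v.
Proof.
move=> Up v v0; apply: fm_pos => //; apply: contra_neq v0 => fv0.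
by apply: f_inj => //; rewrite fv0 linear0.
Qed.

Definition pullback_metric : fibre_metric E :=
  FibreMetric pullback_form_linear pullback_form_sym pullback_form_pos
    pullback_form_smooth.

End FibreMetrics.

Section FibrewiseBijective.
Context {R : realType} {n : nat} {S : manifold R n} {U : set S} {r : nat}.
Context {E F : vbundle U r} (f : vbmor E F).
Hypothesis f_bij : forall p, U p -> bijective (f p).

(** Through [local_mx_rank], this gives the square local matrices full rank. *)
Lemma fibrewise_bij_constant_rank : constant_rank f U r.
Proof.
move=> p Up; have [t Ft tp] := trivs_cover F Up.
by rewrite (bij_limg (f_bij Up)) (bij_dim (tmap_bij tp)) dimvf /dim /= mul1n.
Qed.

Lemma inverse_smooth t t' : trivs (v := F) t -> trivs (v := E) t' ->
  forall w, msmooth (tdom t `&` tdom t')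
    (fun p => tmap t' p ((f p)^-1%VF ((tmap t p)^-1%VF w))).
Proof.
move=> Ft Et' w; apply: msmooth_local => p [tp t'p].
have oW0 : open (tdom t' `&` tdom t) by exact: tdomI.
(* The local matrix is invertible at [p], hence on a neighbourhood [W] with smooth inverse [Mi];
   this is why the claim was first localized. *)
have [W [Mi [oW Wp WW0 sMi MK]]] := smooth_inv erefl oW0 (conj t'p tp)
  (local_mx_smooth f Et' Ft)
  (local_mx_rank fibrewise_bij_constant_rank Et' (conj t'p tp)).
exists W => //; apply: (@msmooth_ext _ _ _ _ _ (fun q => w *m Mi q)) => //.
  move=> q Wq; have [t'q tq] := WW0 _ Wq.
  have [_ fVK] := lfun_bijK (f_bij (trivs_sub Ft tq)).
  (* Vectors are rows, so [w] is the coordinate row of its preimage times the local matrix; [Mi q]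
     on the right then cancels that matrix. *)
  have {1}-> : w = tmap t' q ((f q)^-1%VF ((tmap t q)^-1%VF w)) *m
      local_mx f t' t q.
    by rewrite local_mxE trivK // fVK trivVK.
  by rewrite -mulmxA (MK _ Wq).1 mulmx1.
apply/(smooth_mxrV _ oW); apply: smooth_mx_mul => //.
exact: smooth_mx_cst.
Qed.

Lemma fibrewise_bij_bundle_iso : bundle_iso f.
Proof.
exists (@VBMor _ _ _ _ _ _ F E (fun p => (f p)^-1%VF) inverse_smooth) => p Up.
exact: lfun_bijK (f_bij Up).
Qed.

End FibrewiseBijective.

Section InducedBijective.
Context {R : realType} {n : nat} {S : manifold R n} {U : set S} {r r' : nat}.
Context {E : vbundle U r} {F : vbundle U r'}.
Variables (f : vbmor E F) (s : nat) (rk : constant_rank f U s).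

Lemma coimage_projVK p :
  cancel (coimage_proj rk p)^-1%VF (coimage_proj rk p).
Proof. exact: quot_projVK. Qed.

Lemma induced_vbmor_bij p : bijective (induced_vbmor rk p).
Proof.
(* The inverse sends [y] to the class of some preimage under [f p]. Two preimages differ by an
   element of the kernel, so the choice is immaterial. *)
exists (fun y => coimage_proj rk p ((f p)^-1%VF (vsval y))) => [x|y].
  rewrite -(coimage_projVK x) induced_mapE; apply/quot_projE.
  by rewrite memv_ker linearB /= limg_lfunVK ?subrr // memv_img ?memvf.
by apply: val_inj; rewrite /= induced_mapE limg_lfunVK ?subvsP.
Qed.

End InducedBijective.

Theorem proposition3p4 (R : realType) (n m : nat) (S : manifold R n)
    (Z : vbundle [set: S] m) (hZ : fibre_metric Z)
    (rho : vbmor (tangent_bundle S) Z)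
    (U : set S) (oU : open U) (s : nat) (rk : constant_rank rho U s) :
  let TU := vb_restr oU (tangent_bundle S) in
  let ZU := vb_restr oU Z in
  let rhoU : vbmor TU ZU := vbmor_restr oU rho in
  let rkU : constant_rank rhoU U s := rk in
  let quotTU : vbundle U s := coimage_bundle rkU in
  let q : vbmor TU quotTU := coimage_proj rkU in
  let imU : vbundle U s := image_bundle rkU in
  let hI : fibre_metric imU :=
    sub_metric (image_subbundle rkU) (fm_restr oU hZ) in
  let rhobar : vbmor quotTU imU := induced_vbmor rkU in
  let is_descent (g : fibre_metric quotTU) :=
    forall p, U p -> forall X Y : tangent_space S p,
      pullback_form q g X Y = pullback_form rho hZ X Y in
  exists gbar : fibre_metric quotTU,
    [/\ is_descent gbar,
        (forall g : fibre_metric quotTU, is_descent g ->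
           forall p, U p -> forall x y : quotTU p, g p x y = gbar p x y),
        (forall p, U p -> forall X : tangent_space S p,
           vsval (rhobar p (q p X)) = rho p X),
        bundle_iso rhobar
      & is_isometry gbar hI rhobar].
Proof.
move=> TU ZU rhoU rkU quotTU q imU hI rhobar is_descent.
have rhobarE p X : vsval (rhobar p (q p X)) = rho p X.
  exact: (induced_mapE rkU).
have rhobar_bij p : U p -> bijective (rhobar p).
  by move=> _; exact: induced_vbmor_bij.
pose gbar := pullback_metric hI (fun p Up => bij_inj (rhobar_bij p Up)).
have gbarE : is_descent gbar.
  (* [hI] evaluates [hZ] on underlying vectors, so [rhobarE] makes both sides convertible. *)
  move=> p Up X Y; rewrite -[RHS]/(hZ p (rho p X) (rho p Y)).
  by rewrite -!rhobarE.
(* The isometry clause holds by conversion, [gbar] being the pullback of [hI] along [rhobar]. *)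
exists gbar; split => //.
(* With [x] and [y] written as classes of representatives, both metrics take the value of the
   response form there. *)
- move=> g gE p Up x y; rewrite -(coimage_projVK x) -(coimage_projVK y).
  exact: etrans (gE p Up _ _) (esym (gbarE p Up _ _)).
- exact: fibrewise_bij_bundle_iso.
Qed.
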